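(* In multi-sorted classical first-order logic extended with equivalence atomic formulas $\vec{x}\sim\vec{y}$ and conditional independence atomic formulas $\vec{x}\perp\vec{y}\mid\vec{z}$, every instance of the schema $$(\exists\vec{y}.\ \Phi(\vec{x},\vec{y},\vec{w}))\ \to\ \forall\vec{z}.\ \big(\vec{x}\perp\vec{z}\mid\vec{w}\ \to\ \exists\vec{y}.\ (\vec{x},\vec{y}\perp\vec{z}\mid\vec{w}\ \wedge\ \Phi(\vec{x},\vec{y},\vec{w}))\big)$$ is derivable from the axiom schemas (E1)–(E7) and (I1)–(I7) listed below. Here $\Phi(\vec{x},\vec{y},\vec{w})$ denotes a formula in which every free variable has been substituted by one of the variables in the lists $\vec{x},\vec{y},\vec{w}$.
   Context: Variables have sorts; $\vec{x}$ etc. denote finite lists of variables, with lengths/sorts matching so that formulas are well formed; for lists $\vec{x}_1,\dots,\vec{x}_n$ and $\vec{y}_1,\dots$, the formula $\vec{x}\sim\vec{y}$ requires identical sort lists, and $\vec{x},\vec{y}$ denotes concatenation. Axiom schemas (universally closed): (E1) $\vec{x}\sim\vec{x}$; (E2) $\vec{x}\sim\vec{y}\to\vec{y}\sim\vec{x}$; (E3) $\vec{x}\sim\vec{y}\wedge\vec{y}\sim\vec{z}\to\vec{x}\sim\vec{z}$; (E4) $\vec{x}\sim\vec{y}\to\pi(\vec{x})\sim\pi(\vec{y})$ for any permutation $\pi$ applied to both lists; (E5) $\vec{x},x\sim\vec{y},y\to\vec{x}\sim\vec{y}$; (E6) (invariance) $\vec{x}\sim\vec{y}\wedge\Phi(\vec{x})\to\Phi(\vec{y})$,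 where all free variables of $\Phi$ lie in a list $\vec{z}$ of distinct variables matching $\vec{x}$ in length and sorts, and $\Phi(\vec{x})$, $\Phi(\vec{y})$ are the substitutions of $\vec{x}$, $\vec{y}$ for $\vec{z}$; (E7) (transfer) $\vec{x}\sim\vec{x}'\to\exists y'.\ \vec{x},y\sim\vec{x}',y'$. (I1) $\vec{x}\perp\vec{y}\mid\vec{z}\to\pi(\vec{x})\perp\pi'(\vec{y})\mid\pi''(\vec{z})$ for permutations $\pi,\pi',\pi''$ of the respective lists; (I2) $\vec{x}\perp\vec{y}\mid\vec{y}$; (I3) $\vec{x}\perp\vec{y}\mid\vec{z}\to\vec{y}\perp\vec{x}\mid\vec{z}$; (I4) $\vec{x}\perp\vec{y},\vec{z}\mid\vec{w}\to\vec{x}\perp\vec{y}\mid\vec{w}$; (I5) $\vec{x}\perp\vec{y},\vec{z}\mid\vec{w}\to\vec{x}\perp\vec{y}\mid\vec{z},\vec{w}$; (I6) $\vec{x}\perp\vec{y}\mid\vec{z},\vec{w}\wedge\vec{x}\perp\vec{z}\mid\vec{w}\to\vec{x}\perp\vec{y},\vec{z}\mid\vec{w}$; (I7) (independence principle) $\exists\vec{y}.\ \vec{y},\vec{w}\sim\vec{x},\vec{w}\wedge\vec{y}\perp\vec{z}\mid\vec{w}$ (with $\vec{y}$ fresh, of the same sorts as $\vec{x}$). *)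

(* Defs.v *)
From Stdlib Require List.
From mathcomp Require Import all_boot perm.

Set Implicit Arguments.
Unset Strict Implicit.
Unset Printing Implicit Defensive.

Record signature : Type := Signature {
  sortS : eqType;
  funS : Type;
  dom : funS -> seq sortS;
  cod : funS -> sortS;
  relS : Type;
  arity : relS -> seq sortS }.

(* The variable (s, n) is the n-th variable of sort s.  Bound variables are de
   Bruijn indices counted separately for each sort: under a quantifier of sort
   s, (s, 0) is the bound variable, (s, n.+1) is the outer variable (s, n), and
   the variables of the other sorts are unchanged. *)
Definition var (Sg : signature) : eqType := (sortS Sg * nat)%type.

Definition sorts (Sg : signature) (x : seq (var Sg)) : seq (sortS Sg) :=
  [seq v.1 | v <- x].

Definition shift (Sg : signature) (s : sortS Sg) (v : var Sg) : var Sg :=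
  if v.1 == s then (v.1, v.2.+1) else v.

(* None for the variable bound by a quantifier of sort s. *)
Definition unshift (Sg : signature) (s : sortS Sg) (v : var Sg) :
    option (var Sg) :=
  if v.1 == s then (if v.2 is n.+1 then Some (v.1, n) else None) else Some v.

Inductive term (Sg : signature) : Type :=
| Var of var Sg
| App of funS Sg & seq (term Sg).

Definition tsort (Sg : signature) (t : term Sg) : sortS Sg :=
  match t with
  | Var v => v.1
  | App f _ => cod f
  end.

Fixpoint twf (Sg : signature) (t : term Sg) : bool :=
  match t with
  | Var _ => true
  | App f ts => ([seq tsort u | u <- ts] == dom f) && all (@twf Sg) ts
  end.

Fixpoint tfv (Sg : signature) (t : term Sg) : seq (var Sg) :=
  match t with
  | Var v => [:: v]
  | App _ ts => flatten [seq tfv u | u <- ts]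
  end.

Fixpoint tsubst (Sg : signature) (f : var Sg -> term Sg) (t : term Sg) :
    term Sg :=
  match t with
  | Var v => f v
  | App g ts => App g [seq tsubst f u | u <- ts]
  end.

(* Equiv ts us is ts ~ us, and Indep ts us rs is ts _|_ us | rs.  Their
   arguments are terms only so that formulas are closed under substitution; the
   axiom schemas below apply them to lists of variables. *)
Inductive form (Sg : signature) : Type :=
| Rel of relS Sg & seq (term Sg)
| Eq of term Sg & term Sg
| Equiv of seq (term Sg) & seq (term Sg)
| Indep of seq (term Sg) & seq (term Sg) & seq (term Sg)
| Bot
| Imp of form Sg & form Sg
| And of form Sg & form Sg
| Or of form Sg & form Sg
| All of sortS Sg & form Sg
| Ex of sortS Sg & form Sg.

Arguments Bot {Sg}.

Definition Not (Sg : signature) (A : form Sg) : form Sg := Imp A Bot.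

Fixpoint wf (Sg : signature) (A : form Sg) : bool :=
  match A with
  | Rel r ts => ([seq tsort t | t <- ts] == arity r) && all (@twf Sg) ts
  | Eq t u => [&& tsort t == tsort u, twf t & twf u]
  | Equiv ts us =>
      [&& [seq tsort t | t <- ts] == [seq tsort u | u <- us],
          all (@twf Sg) ts & all (@twf Sg) us]
  | Indep ts us rs =>
      [&& all (@twf Sg) ts, all (@twf Sg) us & all (@twf Sg) rs]
  | Bot => true
  | Imp B C | And B C | Or B C => wf B && wf C
  | All _ B | Ex _ B => wf B
  end.

Fixpoint fv (Sg : signature) (A : form Sg) : seq (var Sg) :=
  match A with
  | Rel _ ts => flatten [seq tfv t | t <- ts]
  | Eq t u => tfv t ++ tfv u
  | Equiv ts us =>
      flatten [seq tfv t | t <- ts] ++ flatten [seq tfv u | u <- us]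
  | Indep ts us rs =>
      flatten [seq tfv t | t <- ts] ++ flatten [seq tfv u | u <- us]
        ++ flatten [seq tfv r | r <- rs]
  | Bot => [::]
  | Imp B C | And B C | Or B C => fv B ++ fv C
  | All s B | Ex s B => pmap (unshift s) (fv B)
  end.

Definition tshift (Sg : signature) (s : sortS Sg) : term Sg -> term Sg :=
  tsubst (fun v => Var (shift s v)).

Definition up (Sg : signature) (s : sortS Sg) (f : var Sg -> term Sg) :
    var Sg -> term Sg :=
  fun v => if unshift s v is Some u then tshift s (f u) else Var v.

(* Simultaneous capture-avoiding substitution. *)
Fixpoint subst (Sg : signature) (f : var Sg -> term Sg) (A : form Sg) :
    form Sg :=
  match A with
  | Rel r ts => Rel r [seq tsubst f t | t <- ts]
  | Eq t u => Eq (tsubst f t) (tsubst f u)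
  | Equiv ts us => Equiv [seq tsubst f t | t <- ts] [seq tsubst f u | u <- us]
  | Indep ts us rs =>
      Indep [seq tsubst f t | t <- ts] [seq tsubst f u | u <- us]
            [seq tsubst f r | r <- rs]
  | Bot => Bot
  | Imp B C => Imp (subst f B) (subst f C)
  | And B C => And (subst f B) (subst f C)
  | Or B C => Or (subst f B) (subst f C)
  | All s B => All s (subst (up s f) B)
  | Ex s B => Ex s (subst (up s f) B)
  end.

Definition fshift (Sg : signature) (s : sortS Sg) : form Sg -> form Sg :=
  subst (fun v => Var (shift s v)).

(* The body A of a quantifier of sort s, with its bound variable replaced by t. *)
Definition inst (Sg : signature) (s : sortS Sg) (t : term Sg) (A : form Sg) :
    form Sg :=
  subst (fun v => if unshift s v is Some u then Var u else t) A.

(* Natural deduction for many-sorted classical logic with equality, from a set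
   T of sentences; as T is closed, its members need no shift under a
   quantifier.  The side conditions keep every formula well formed. *)
Inductive derives (Sg : signature) (T : form Sg -> Prop) :
    seq (form Sg) -> form Sg -> Prop :=
| d_ax G A : T A -> derives T G A
| d_hyp G A : List.In A G -> derives T G A
| d_raa G A : wf A -> derives T (Not A :: G) Bot -> derives T G A
| d_impI G A B : wf A -> derives T (A :: G) B -> derives T G (Imp A B)
| d_impE G A B : derives T G (Imp A B) -> derives T G A -> derives T G B
| d_andI G A B : derives T G A -> derives T G B -> derives T G (And A B)
| d_andE1 G A B : derives T G (And A B) -> derives T G A
| d_andE2 G A B : derives T G (And A B) -> derives T G B
| d_orI1 G A B : wf B -> derives T G A -> derives T G (Or A B)
| d_orI2 G A B : wf A -> derives T G B -> derives T G (Or A B)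
| d_orE G A B C : derives T G (Or A B) ->
    derives T (A :: G) C -> derives T (B :: G) C -> derives T G C
| d_allI G s A : derives T [seq fshift s B | B <- G] A -> derives T G (All s A)
| d_allE G s A t : tsort t = s -> twf t ->
    derives T G (All s A) -> derives T G (inst s t A)
| d_exI G s A t : tsort t = s -> twf t -> wf A ->
    derives T G (inst s t A) -> derives T G (Ex s A)
| d_exE G s A B : derives T G (Ex s A) ->
    derives T (A :: [seq fshift s C | C <- G]) (fshift s B) -> derives T G B
| d_eqI G t : twf t -> derives T G (Eq t t)
| d_eqE G s A t u : tsort t = s -> tsort u = s -> wf A ->
    derives T G (Eq t u) -> derives T G (inst s t A) -> derives T G (inst s u A).

(* Quantification over a named variable: the free occurrences of x in A become
   the bound index, all other free variables keep their name. *)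
Definition abs (Sg : signature) (x : var Sg) (A : form Sg) : form Sg :=
  subst (fun v => Var (if v == x then (x.1, 0) else shift x.1 v)) A.

Definition all_vars (Sg : signature) (x : seq (var Sg)) (A : form Sg) :
    form Sg :=
  foldr (fun v B => All v.1 (abs v B)) A x.

Definition ex_vars (Sg : signature) (x : seq (var Sg)) (A : form Sg) :
    form Sg :=
  foldr (fun v B => Ex v.1 (abs v B)) A x.

Definition univ_closure (Sg : signature) (A : form Sg) : form Sg :=
  all_vars (undup (fv A)) A.

Definition subst_vars (Sg : signature) (z x : seq (var Sg)) (A : form Sg) :
    form Sg :=
  subst (fun v => Var (nth v x (index v z))) A.

Definition equiv (Sg : signature) (x y : seq (var Sg)) : form Sg :=
  Equiv (map (@Var Sg) x) (map (@Var Sg) y).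

Definition indep (Sg : signature) (x y z : seq (var Sg)) : form Sg :=
  Indep (map (@Var Sg) x) (map (@Var Sg) y) (map (@Var Sg) z).

Definition permute (T : Type) (n : nat) (p : 'S_n) (x : n.-tuple T) :
    n.-tuple T :=
  [tuple tnth x (p i) | i < n].

Definition disjoint_vars (Sg : signature) (x y : seq (var Sg)) : bool :=
  ~~ has (mem y) x.

Inductive EI_schema (Sg : signature) : form Sg -> Prop :=
| E1 x : EI_schema (equiv x x)
| E2 x y : sorts x = sorts y ->
    EI_schema (Imp (equiv x y) (equiv y x))
| E3 x y z : sorts x = sorts y -> sorts y = sorts z ->
    EI_schema (Imp (And (equiv x y) (equiv y z)) (equiv x z))
| E4 n (p : 'S_n) (x y : n.-tuple (var Sg)) : sorts x = sorts y ->
    EI_schema (Imp (equiv x y) (equiv (permute p x) (permute p y)))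
| E5 x y (u v : var Sg) : sorts x = sorts y -> u.1 = v.1 ->
    EI_schema (Imp (equiv (x ++ [:: u]) (y ++ [:: v])) (equiv x y))
| E6 x y z A : wf A -> uniq z -> {subset fv A <= z} ->
    sorts x = sorts z -> sorts y = sorts z ->
    EI_schema (Imp (And (equiv x y) (subst_vars z x A)) (subst_vars z y A))
| E7 x x' (y y' : var Sg) : sorts x = sorts x' -> y'.1 = y.1 ->
    y' \notin x ++ x' ++ [:: y] ->
    EI_schema (Imp (equiv x x')
                   (ex_vars [:: y'] (equiv (x ++ [:: y]) (x' ++ [:: y']))))
| I1 k m n (p : 'S_k) (q : 'S_m) (r : 'S_n)
     (x : k.-tuple (var Sg)) (y : m.-tuple (var Sg)) (z : n.-tuple (var Sg)) :
    EI_schema (Imp (indep x y z)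
                   (indep (permute p x) (permute q y) (permute r z)))
| I2 x y : EI_schema (indep x y y)
| I3 x y z : EI_schema (Imp (indep x y z) (indep y x z))
| I4 x y z w : EI_schema (Imp (indep x (y ++ z) w) (indep x y w))
| I5 x y z w : EI_schema (Imp (indep x (y ++ z) w) (indep x y (z ++ w)))
| I6 x y z w :
    EI_schema (Imp (And (indep x y (z ++ w)) (indep x z w))
                   (indep x (y ++ z) w))
| I7 x y z w : sorts y = sorts x -> uniq y -> disjoint_vars y (x ++ z ++ w) ->
    EI_schema (ex_vars y (And (equiv (y ++ w) (x ++ w)) (indep y z w))).

Definition EI_axioms (Sg : signature) (A : form Sg) : Prop :=
  exists2 B, EI_schema B & A = univ_closure B.

(* Main.v *)
(** Given [y] with [Phi (x, y, w)], the independence principle (I7) over the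
    base [x, w] yields a fresh copy [y'] with [y', x, w ~ y, x, w] and
    [y' _|_ z | x, w].  Invariance (E6) transports [Phi] to [y'], and (I6)
    combines [z _|_ y' | x, w] with [z _|_ x | w] into [z _|_ y', x | w]. *)
Require Import Defs.
From mathcomp Require Import all_boot perm.

Set Implicit Arguments.
Unset Strict Implicit.
Unset Printing Implicit Defensive.

(** * Substitution *)

(** Arguments of [App] are nested in a list, so the generated induction principle gives no
    hypothesis for them; [List.Forall] supplies it. *)
Lemma term_nested_ind (Sg : signature) (P : term Sg -> Prop) :
    (forall v, P (Var v)) ->
    (forall f ts, List.Forall P ts -> P (App f ts)) ->
  forall t, P t.
Proof.
move=> PVar PApp; fix IH 1; case=> [v|f ts]; first exact: PVar.
by apply: PApp; elim: ts => [|t ts IHts]; constructor.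
Qed.

Lemma eq_map_Forall (T U : Type) (f g : T -> U) (s : seq T) :
  List.Forall (fun a => f a = g a) s -> map f s = map g s.
Proof. by elim=> //= a s' -> _ ->. Qed.

Lemma tsubst_comp (Sg : signature) (f g : var Sg -> term Sg) (t : term Sg) :
  tsubst g (tsubst f t) = tsubst (tsubst g \o f) t.
Proof.
elim/term_nested_ind: t => //= h ts IH.
by rewrite -map_comp; congr App; apply: eq_map_Forall.
Qed.

Lemma map_tsubst_comp (Sg : signature) (f g : var Sg -> term Sg)
    (ts : seq (term Sg)) :
  map (tsubst g) (map (tsubst f) ts) = map (tsubst (tsubst g \o f)) ts.
Proof. by rewrite -map_comp; apply: eq_map => t; apply: tsubst_comp. Qed.

Lemma eq_in_tsubst (Sg : signature) (f g : var Sg -> term Sg) (t : term Sg) :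
  {in tfv t, f =1 g} -> tsubst f t = tsubst g t.
Proof.
elim/term_nested_ind: t => [v|h ts IH] /= efg; first by apply: efg; rewrite inE.
congr App; elim: IH efg => //= t ts' IHt _ IHts efg.
rewrite IHt ?IHts // => v v_in; apply: efg; rewrite mem_cat v_in ?orbT //.
Qed.

Lemma eq_in_map_tsubst (Sg : signature) (f g : var Sg -> term Sg)
    (ts : seq (term Sg)) :
  {in flatten [seq tfv t | t <- ts], f =1 g} ->
  map (tsubst f) ts = map (tsubst g) ts.
Proof.
elim: ts => //= t ts IH efg; rewrite (@eq_in_tsubst _ f g) ?IH // => v v_in;
  by apply: efg; rewrite mem_cat v_in ?orbT.
Qed.

Lemma unshift_shift (Sg : signature) (s : sortS Sg) :
  pcancel (shift s) (unshift s).
Proof.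
case=> a n; rewrite /shift /unshift /=.
by case: (a =P s) => [->|/eqP/negPf] /= => [|->]; rewrite ?eqxx.
Qed.

Lemma shift_unshift (Sg : signature) (s : sortS Sg) (u v : var Sg) :
  unshift s v = Some u -> v = shift s u.
Proof.
case: v => a [|n]; rewrite /unshift /shift /=; case: ifP => e // [<-] /=;
  by rewrite e.
Qed.

Lemma unshift0 (Sg : signature) (s : sortS Sg) : unshift s (s, 0) = None.
Proof. by rewrite /unshift eqxx. Qed.

Lemma up_shift (Sg : signature) (s : sortS Sg) (f : var Sg -> term Sg) v :
  up s f (shift s v) = tshift s (f v).
Proof. by rewrite /up unshift_shift. Qed.

(** Every [up s f] sends the bound index to itself, so two such maps can differ only at outer
    variables. *)
Lemma eq_in_up (Sg : signature) (s : sortS Sg) (f g : var Sg -> term Sg)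
    (r : seq (var Sg)) :
  {in pmap (unshift s) r, f =1 g} -> {in r, up s f =1 up s g}.
Proof.
move=> efg v v_in; rewrite /up; case e: (unshift s v) => [u|//].
by rewrite efg // mem_pmap -e map_f.
Qed.

Lemma eq_in_subst (Sg : signature) (A : form Sg) (f g : var Sg -> term Sg) :
  {in fv A, f =1 g} -> subst f A = subst g A.
Proof.
have sub (a b : seq (var Sg)) (h k : var Sg -> term Sg) :
    {in a ++ b, h =1 k} -> {in a, h =1 k} /\ {in b, h =1 k}.
  by move=> e; split=> v v_in; apply: e; rewrite mem_cat v_in ?orbT.
elim: A f g => [r ts|t u|ts us|ts us rs||B IHB C IHC|B IHB C IHC|B IHB C IHC
  |s B IH|s B IH] f g //=.
- by move=> e; rewrite (eq_in_map_tsubst e).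
- by move/sub=> [e1 e2]; rewrite (eq_in_tsubst e1) (eq_in_tsubst e2).
- by move/sub=> [e1 e2]; rewrite (eq_in_map_tsubst e1) (eq_in_map_tsubst e2).
- move/sub=> [e1 /sub[e2 e3]].
  by rewrite (eq_in_map_tsubst e1) (eq_in_map_tsubst e2) (eq_in_map_tsubst e3).
- by move/sub=> [/IHB-> /IHC->].
- by move/sub=> [/IHB-> /IHC->].
- by move/sub=> [/IHB-> /IHC->].
- by move/eq_in_up/IH=> ->.
- by move/eq_in_up/IH=> ->.
Qed.

Lemma eq_subst (Sg : signature) (A : form Sg) (f g : var Sg -> term Sg) :
  f =1 g -> subst f A = subst g A.
Proof. by move=> efg; apply: eq_in_subst => v _; apply: efg. Qed.

Lemma tsubst_Var (Sg : signature) (t : term Sg) : tsubst (@Var Sg) t = t.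
Proof.
elim/term_nested_ind: t => //= f ts IH.
by congr App; rewrite -[RHS]map_id; apply: eq_map_Forall.
Qed.

Lemma up_Var (Sg : signature) (s : sortS Sg) : up s (@Var Sg) =1 @Var Sg.
Proof.
by move=> v; rewrite /up; case e: unshift => [u|//]; rewrite (shift_unshift e).
Qed.

Lemma subst_Var (Sg : signature) (A : form Sg) : subst (@Var Sg) A = A.
Proof.
have mapV (ts : seq (term Sg)) : map (tsubst (@Var Sg)) ts = ts.
  by rewrite -[RHS]map_id; apply: eq_map => t; apply: tsubst_Var.
elim: A => //= [r ts|t u|ts us|ts us rs|B -> C ->|B -> C ->|B -> C ->
  |s B IH|s B IH] //; rewrite ?mapV ?tsubst_Var //.
- by rewrite (eq_subst _ (@up_Var _ s)) IH.
- by rewrite (eq_subst _ (@up_Var _ s)) IH.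
Qed.

Lemma subst_indep (Sg : signature) (r : var Sg -> var Sg)
    (x y z : seq (var Sg)) :
  subst (fun v => Var (r v)) (indep x y z) =
  indep (map r x) (map r y) (map r z).
Proof. by rewrite /indep /= -!map_comp. Qed.

Lemma tsubst_tshift (Sg : signature) (s : sortS Sg) (f : var Sg -> term Sg)
    (t : term Sg) :
  tsubst (up s f) (tshift s t) = tshift s (tsubst f t).
Proof.
by rewrite /tshift !tsubst_comp; apply: eq_in_tsubst => v _ /=; rewrite up_shift.
Qed.

Lemma up_comp (Sg : signature) (s : sortS Sg) (f g : var Sg -> term Sg) :
  tsubst (up s g) \o up s f =1 up s (tsubst g \o f).
Proof.
move=> v /=; rewrite [up s f v]/up [RHS]/up.
case e: (unshift s v) => [u|] /=; first by rewrite tsubst_tshift.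
by rewrite /up e.
Qed.

Lemma subst_comp (Sg : signature) (A : form Sg) (f g : var Sg -> term Sg) :
  subst g (subst f A) = subst (tsubst g \o f) A.
Proof.
elim: A f g => [r ts|t u|ts us|ts us rs||B IHB C IHC|B IHB C IHC|B IHB C IHC
  |s B IH|s B IH] f g //=; rewrite ?map_tsubst_comp ?tsubst_comp ?IHB ?IHC //.
- by rewrite IH (eq_subst _ (@up_comp _ s f g)).
- by rewrite IH (eq_subst _ (@up_comp _ s f g)).
Qed.

Lemma subst_fshift (Sg : signature) (s : sortS Sg) (f : var Sg -> term Sg) A :
  subst (up s f) (fshift s A) = fshift s (subst f A).
Proof. by rewrite /fshift !subst_comp; apply: eq_subst => v /=; rewrite up_shift. Qed.

Lemma tsubst_inst_tshift (Sg : signature) (s : sortS Sg) (t u : term Sg) :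
  tsubst (fun v => if unshift s v is Some v' then Var v' else t) (tshift s u)
    = u.
Proof.
rewrite /tshift tsubst_comp -[RHS]tsubst_Var.
by apply: eq_in_tsubst => v _ /=; rewrite unshift_shift.
Qed.

(** Lets a substitution pass through the deduction rules that are stated with [inst]. *)
Lemma subst_inst (Sg : signature) (s : sortS Sg) (t : term Sg)
    (f : var Sg -> term Sg) (A : form Sg) :
  subst f (inst s t A) = inst s (tsubst f t) (subst (up s f) A).
Proof.
rewrite /inst !subst_comp; apply: eq_subst => v /=; rewrite /up.
by case e: (unshift s v) => [u|] /=; rewrite ?tsubst_inst_tshift ?e.
Qed.

(** Links named and indexed binding: [abs v] turns [v] into the bound index, [inst] replaces that
    index by [t], and [f] acts on the remaining variables. *)
Lemma inst_up_abs (Sg : signature) (v : var Sg) (t : term Sg)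
    (f : var Sg -> term Sg) (A : form Sg) :
  inst v.1 t (subst (up v.1 f) (abs v A)) =
  subst (fun u => if u == v then t else f u) A.
Proof.
rewrite /inst /abs !subst_comp; apply: eq_subst => u /=.
case: eqP => _; first by rewrite /up unshift0 /= unshift0.
by rewrite up_shift tsubst_inst_tshift.
Qed.

(** * Free variables and well-formedness *)

Lemma tfv_tsubst (Sg : signature) (f : var Sg -> term Sg) (t : term Sg) u :
  u \in tfv (tsubst f t) -> exists2 v, v \in tfv t & u \in tfv (f v).
Proof.
elim/term_nested_ind: t => [v|h ts IH] /=; first by exists v; rewrite ?inE.
elim: IH => //= t ts' IHt _ IHts; rewrite mem_cat => /orP[/IHt|/IHts] [v v_in uv];
  by exists v; rewrite // mem_cat v_in ?orbT.
Qed.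

Lemma tfv_map_tsubst (Sg : signature) (f : var Sg -> term Sg)
    (ts : seq (term Sg)) u :
  u \in flatten [seq tfv t | t <- map (tsubst f) ts] ->
  exists2 v, v \in flatten [seq tfv t | t <- ts] & u \in tfv (f v).
Proof.
elim: ts => //= t ts IH; rewrite mem_cat => /orP[/tfv_tsubst|/IH] [v v_in uv];
  by exists v; rewrite // mem_cat v_in ?orbT.
Qed.

(** The quantifier step of [fv_subst]. The bound index yields only itself, which [unshift] drops;
    every other value is a shifted term, whose shift [unshift] removes. *)
Lemma pmap_unshift_fv_up (Sg : signature) (s : sortS Sg)
    (f : var Sg -> term Sg) (r r' : seq (var Sg)) :
  (forall u, u \in r -> exists2 v, v \in r' & u \in tfv (up s f v)) ->
  forall u, u \in pmap (unshift s) r ->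
    exists2 v, v \in pmap (unshift s) r' & u \in tfv (f v).
Proof.
move=> rr' u; rewrite mem_pmap => /mapP[u' /rr'[v v_in]]; rewrite /up.
case e: (unshift s v) => [v'|] /=; last first.
  by rewrite inE => /eqP->; rewrite e.
move/tfv_tsubst=> [u'' u''_in]; rewrite inE => /eqP->.
rewrite unshift_shift => -[->]; exists v' => //.
by rewrite mem_pmap -e map_f.
Qed.

Lemma fv_subst (Sg : signature) (A : form Sg) (f : var Sg -> term Sg) u :
  u \in fv (subst f A) -> exists2 v, v \in fv A & u \in tfv (f v).
Proof.
have fv_cat (a b a' b' : seq (var Sg)) (g : var Sg -> term Sg) u' :
    (u' \in a' -> exists2 v, v \in a & u' \in tfv (g v)) ->
    (u' \in b' -> exists2 v, v \in b & u' \in tfv (g v)) ->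
    u' \in a' ++ b' -> exists2 v, v \in a ++ b & u' \in tfv (g v).
  move=> Ha Hb; rewrite mem_cat => /orP[/Ha|/Hb] [v v_in uv];
    by exists v; rewrite // mem_cat v_in ?orbT.
elim: A f u => [r ts|t t'|ts us|ts us rs||B IHB C IHC|B IHB C IHC|B IHB C IHC
  |s B IH|s B IH] f u //=.
- exact: tfv_map_tsubst.
- by apply: fv_cat; apply: tfv_tsubst.
- by apply: fv_cat; apply: tfv_map_tsubst.
- apply: (fv_cat); first exact: tfv_map_tsubst.
  by apply: fv_cat; apply: tfv_map_tsubst.
- by apply: fv_cat; [apply: IHB|apply: IHC].
- by apply: fv_cat; [apply: IHB|apply: IHC].
- by apply: fv_cat; [apply: IHB|apply: IHC].
- by apply: pmap_unshift_fv_up => v; apply: IH.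
- by apply: pmap_unshift_fv_up => v; apply: IH.
Qed.

(** [abs x] replaces [x] by the bound index, which [unshift] discards, and shifts the other
    variables, which [unshift] undoes. *)
Lemma pmap_unshift_fv_abs (Sg : signature) (x : var Sg) (A : form Sg) u :
  u \in pmap (unshift x.1) (fv (abs x A)) -> u \in fv A /\ u != x.
Proof.
rewrite mem_pmap => /mapP[u' /fv_subst[v v_in]] /=; rewrite inE => /eqP->.
case: (v =P x) => [_|/eqP nvx]; first by rewrite unshift0.
by rewrite unshift_shift => -[->].
Qed.

Lemma fv_all_vars (Sg : signature) (xs : seq (var Sg)) (A : form Sg) u :
  u \in fv (all_vars xs A) -> u \in fv A /\ u \notin xs.
Proof.
elim: xs => //= x xs IH /pmap_unshift_fv_abs[/IH[-> u_xs] u_x].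
by rewrite inE negb_or u_x.
Qed.

Lemma fv_ex_vars (Sg : signature) (xs : seq (var Sg)) (A : form Sg) u :
  u \in fv (ex_vars xs A) -> u \in fv A /\ u \notin xs.
Proof.
elim: xs => //= x xs IH /pmap_unshift_fv_abs[/IH[-> u_xs] u_x].
by rewrite inE negb_or u_x.
Qed.

Lemma fv_univ_closure (Sg : signature) (A : form Sg) :
  fv (univ_closure A) =i [::].
Proof.
by move=> u; apply/negP => /fv_all_vars[]; rewrite mem_undup => ->.
Qed.

Lemma flatten_tfv_Var (Sg : signature) (x : seq (var Sg)) :
  flatten [seq tfv t | t <- map (@Var Sg) x] = x.
Proof. by elim: x => //= v x ->. Qed.

Lemma fv_indep (Sg : signature) (x y z : seq (var Sg)) :
  fv (indep x y z) = x ++ y ++ z.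
Proof. by rewrite /= !flatten_tfv_Var. Qed.

(** The side conditions on terms in the quantifier rules, imposed on every value of [f]; under them
    substitution preserves [wf]. *)
Definition well_sorted (Sg : signature) (f : var Sg -> term Sg) : Prop :=
  forall v, tsort (f v) = v.1 /\ twf (f v).

Lemma well_sorted_Var (Sg : signature) (r : var Sg -> var Sg) :
  (forall v, (r v).1 = v.1) -> well_sorted (fun v => Var (r v)).
Proof. by move=> rE v; split; rewrite /= ?rE. Qed.

Lemma shift_sort (Sg : signature) (s : sortS Sg) (v : var Sg) :
  (shift s v).1 = v.1.
Proof. by rewrite /shift; case: ifP. Qed.

Lemma abs_sort (Sg : signature) (x v : var Sg) :
  (if v == x then (x.1, 0) else shift x.1 v).1 = v.1.
Proof. by case: eqP => [->|_] //; apply: shift_sort. Qed.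

Lemma tsort_tsubst (Sg : signature) (f : var Sg -> term Sg) (t : term Sg) :
  well_sorted f -> tsort (tsubst f t) = tsort t.
Proof. by case: t => //= v /(_ v)[]. Qed.

Lemma map_tsort_tsubst (Sg : signature) (f : var Sg -> term Sg)
    (ts : seq (term Sg)) :
  well_sorted f -> map (@tsort Sg) (map (tsubst f) ts) = map (@tsort Sg) ts.
Proof.
by move=> wsf; rewrite -map_comp; apply: eq_map => t; apply: tsort_tsubst.
Qed.

Lemma twf_tsubst (Sg : signature) (f : var Sg -> term Sg) (t : term Sg) :
  well_sorted f -> twf t -> twf (tsubst f t).
Proof.
move=> wsf; elim/term_nested_ind: t => /= [v _|h ts IH]; first by case: (wsf v).
rewrite map_tsort_tsubst // => /andP[-> /=].
by elim: IH => //= t ts' IHt _ IHts /andP[/IHt-> /IHts].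
Qed.

Lemma all_twf_tsubst (Sg : signature) (f : var Sg -> term Sg)
    (ts : seq (term Sg)) :
  well_sorted f -> all (@twf Sg) ts -> all (@twf Sg) (map (tsubst f) ts).
Proof.
by move=> wsf; rewrite all_map; apply: sub_all => t /=; apply: twf_tsubst.
Qed.

Lemma well_sorted_up (Sg : signature) (s : sortS Sg) (f : var Sg -> term Sg) :
  well_sorted f -> well_sorted (up s f).
Proof.
move=> wsf v; rewrite /up; case e: (unshift s v) => [u|//].
have wsS : well_sorted (fun v => Var (shift s v)).
  exact/well_sorted_Var/shift_sort.
rewrite /tshift tsort_tsubst //; case: (wsf u) => -> wfu; split.
  by rewrite (shift_unshift e) shift_sort.
exact: twf_tsubst.
Qed.

Lemma wf_subst (Sg : signature) (A : form Sg) (f : var Sg -> term Sg) :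
  well_sorted f -> wf A -> wf (subst f A).
Proof.
elim: A f => [r ts|t t'|ts us|ts us rs||B IHB C IHC|B IHB C IHC|B IHB C IHC
  |s B IH|s B IH] f wsf //=.
- by rewrite map_tsort_tsubst // => /andP[-> /all_twf_tsubst->].
- by rewrite !tsort_tsubst // => /and3P[-> /twf_tsubst-> // /twf_tsubst->].
- rewrite !map_tsort_tsubst //.
  by move=> /and3P[-> /all_twf_tsubst-> // /all_twf_tsubst->].
- move=> /and3P[/all_twf_tsubst-> //].
  by move=> /all_twf_tsubst-> // /all_twf_tsubst->.
- by move=> /andP[/IHB-> // /IHC->].
- by move=> /andP[/IHB-> // /IHC->].
- by move=> /andP[/IHB-> // /IHC->].
- by apply: IH; apply: well_sorted_up.
- by apply: IH; apply: well_sorted_up.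
Qed.

Lemma wf_abs (Sg : signature) (x : var Sg) (A : form Sg) :
  wf A -> wf (abs x A).
Proof. exact/wf_subst/well_sorted_Var/abs_sort. Qed.

Lemma wf_ex_vars (Sg : signature) (xs : seq (var Sg)) (A : form Sg) :
  wf A -> wf (ex_vars xs A).
Proof. by elim: xs => //= x xs IH /IH; apply: wf_abs. Qed.

Lemma all_twf_Var (Sg : signature) (x : seq (var Sg)) :
  all (@twf Sg) (map (@Var Sg) x).
Proof. by elim: x. Qed.

Lemma wf_indep (Sg : signature) (x y z : seq (var Sg)) : wf (indep x y z).
Proof. by rewrite /= !all_twf_Var. Qed.

Lemma wf_equiv (Sg : signature) (x y : seq (var Sg)) :
  sorts x = sorts y -> wf (Defs.equiv x y).
Proof.
by move=> exy; rewrite /= !all_twf_Var -!map_comp !andbT; apply/eqP.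
Qed.

(** * Derived rules *)

Lemma incl_cons2 (T : Type) (a : T) (s t : seq T) :
  List.incl s t -> List.incl (a :: s) (a :: t).
Proof. by move=> st b /= [->|/st]; [left|right]. Qed.

(** Stated for inclusion of contexts, so that exchange and contraction are covered as well. *)
Lemma derives_weaken (Sg : signature) (T : form Sg -> Prop)
    (G H : seq (form Sg)) (A : form Sg) :
  derives T G A -> List.incl G H -> derives T H A.
Proof.
move=> D; elim: D H => {G A}.
- by move=> G A TA H _; apply: d_ax.
- by move=> G A AG H GH; apply/d_hyp/GH.
- by move=> G A wA _ IH H GH; apply: d_raa => //; apply/IH/incl_cons2.
- by move=> G A B wA _ IH H GH; apply: d_impI => //; apply/IH/incl_cons2.
- by move=> G A B _ IH1 _ IH2 H GH; apply: d_impE (IH1 _ GH) (IH2 _ GH).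
- by move=> G A B _ IH1 _ IH2 H GH; apply: d_andI (IH1 _ GH) (IH2 _ GH).
- by move=> G A B _ IH H GH; apply: d_andE1 (IH _ GH).
- by move=> G A B _ IH H GH; apply: d_andE2 (IH _ GH).
- by move=> G A B wB _ IH H GH; apply: d_orI1 (IH _ GH).
- by move=> G A B wA _ IH H GH; apply: d_orI2 (IH _ GH).
- move=> G A B C _ IH _ IHA _ IHB H GH; apply: d_orE (IH _ GH) _ _.
    exact/IHA/incl_cons2.
  exact/IHB/incl_cons2.
- by move=> G s A _ IH H GH; apply/d_allI/IH/List.incl_map.
- by move=> G s A t st wt _ IH H GH; apply: d_allE (IH _ GH).
- by move=> G s A t st wt wA _ IH H GH; apply: d_exI st wt wA (IH _ GH).
- move=> G s A B _ IH _ IHA H GH; apply: d_exE (IH _ GH) _.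
  exact/IHA/incl_cons2/List.incl_map.
- by move=> G t wt H _; apply: d_eqI.
- move=> G s A t u st su wA _ IH1 _ IH2 H GH.
  exact: d_eqE st su wA (IH1 _ GH) (IH2 _ GH).
Qed.

Lemma map_subst_fshift (Sg : signature) (s : sortS Sg)
    (f : var Sg -> term Sg) (G : seq (form Sg)) :
  map (subst (up s f)) (map (fshift s) G) = map (fshift s) (map (subst f) G).
Proof. by rewrite -!map_comp; apply: eq_map => A; apply: subst_fshift. Qed.

(** Axioms are left unchanged because they are closed. The induction keeps [f] general, since under
    a binder it becomes [up s f]. *)
Lemma derives_subst (Sg : signature) (T : form Sg -> Prop)
    (G : seq (form Sg)) (A : form Sg) (f : var Sg -> term Sg) :
    (forall B, T B -> fv B =i [::]) -> well_sorted f ->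
  derives T G A -> derives T (map (subst f) G) (subst f A).
Proof.
move=> closedT wsf D; elim: D f wsf => {G A}.
- move=> G A TA f _; rewrite (@eq_in_subst _ A f (@Var Sg)) ?subst_Var.
    exact: d_ax.
  by move=> v; rewrite closedT.
- by move=> G A AG f _; apply/d_hyp/List.in_map.
- by move=> G A wA _ IH f wsf; apply: d_raa (IH f wsf); apply: wf_subst.
- by move=> G A B wA _ IH f wsf; apply: d_impI (IH f wsf); apply: wf_subst.
- by move=> G A B _ IH1 _ IH2 f wsf; apply: d_impE (IH1 f wsf) (IH2 f wsf).
- by move=> G A B _ IH1 _ IH2 f wsf; apply: d_andI (IH1 f wsf) (IH2 f wsf).
- by move=> G A B _ IH f wsf; apply: d_andE1 (IH f wsf).
- by move=> G A B _ IH f wsf; apply: d_andE2 (IH f wsf).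
- by move=> G A B wB _ IH f wsf; apply: d_orI1 (IH f wsf); apply: wf_subst.
- by move=> G A B wA _ IH f wsf; apply: d_orI2 (IH f wsf); apply: wf_subst.
- move=> G A B C _ IH _ IHA _ IHB f wsf.
  exact: d_orE (IH f wsf) (IHA f wsf) (IHB f wsf).
- move=> G s A _ IH f wsf; apply: d_allI.
  by rewrite -map_subst_fshift; apply/IH/well_sorted_up.
- move=> G s A t st wt _ IH f wsf; rewrite subst_inst.
  by apply: d_allE (IH f wsf); rewrite ?tsort_tsubst ?twf_tsubst.
- move=> G s A t st wt wA _ IH f wsf.
  apply: (@d_exI _ _ _ _ _ (tsubst f t)); rewrite ?tsort_tsubst ?twf_tsubst //.
    exact/wf_subst/wA/well_sorted_up.
  by rewrite -subst_inst; apply: IH.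
- move=> G s A B _ IH _ IHA f wsf; apply: d_exE (IH f wsf) _.
  by rewrite -map_subst_fshift -subst_fshift; apply/(IHA (up s f))/well_sorted_up.
- by move=> G t wt f wsf; apply/d_eqI/twf_tsubst.
- move=> G s A t u st su wA _ IH1 _ IH2 f wsf; rewrite subst_inst.
  apply: (@d_eqE _ _ _ s _ (tsubst f t)); rewrite ?tsort_tsubst //.
  + exact/wf_subst/wA/well_sorted_up.
  + exact: IH1.
  + by rewrite -subst_inst; apply: IH2.
Qed.

Lemma derives_cut (Sg : signature) (T : form Sg -> Prop)
    (G : seq (form Sg)) (A B : form Sg) :
  wf A -> derives T G A -> derives T (A :: G) B -> derives T G B.
Proof. by move=> wA DA DB; apply: d_impE DA; apply: d_impI. Qed.

(** * Quantifier rules for lists of named variables *)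

Lemma abs_fresh (Sg : signature) (x : var Sg) (A : form Sg) :
  x \notin fv A -> abs x A = fshift x.1 A.
Proof.
move=> xA; apply: eq_in_subst => v vA.
by case: eqP => // e; rewrite -e vA in xA.
Qed.

Lemma map_abs_fresh (Sg : signature) (x : var Sg) (G : seq (form Sg)) :
  (forall B, List.In B G -> x \notin fv B) ->
  map (abs x) G = map (fshift x.1) G.
Proof. by move=> xG; apply: List.map_ext_in => B /xG/abs_fresh. Qed.

(** The renaming behind [abs x], applied to a whole derivation, turns [x] into the bound index. As
    [x] is fresh for the context, it acts there as the shift that [d_allI] demands. *)
Lemma derives_all_vars (Sg : signature) (T : form Sg -> Prop)
    (G : seq (form Sg)) (xs : seq (var Sg)) (A : form Sg) :
    (forall B, T B -> fv B =i [::]) ->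
    (forall B, List.In B G -> {in xs, forall x, x \notin fv B}) ->
  derives T G A -> derives T G (all_vars xs A).
Proof.
move=> closedT freshG D; elim: xs freshG => //= x xs IH freshG.
apply: d_allI; rewrite -map_abs_fresh; last first.
  by move=> B BG; apply: freshG BG _ _; rewrite mem_head.
apply: derives_subst (IH _) => //; first exact/well_sorted_Var/abs_sort.
by move=> B BG v v_in; apply: freshG BG _ _; rewrite inE v_in orbT.
Qed.

(** The same renaming serves existential elimination: the variables of [xs] are eigenvariables,
    hence fresh for the conclusion as well. *)
Lemma derives_ex_vars_hyp (Sg : signature) (T : form Sg -> Prop)
    (G : seq (form Sg)) (xs : seq (var Sg)) (A C : form Sg) :
    (forall B, T B -> fv B =i [::]) ->
    (forall B, List.In B (C :: G) -> {in xs, forall x, x \notin fv B}) ->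
  derives T (A :: G) C -> derives T (ex_vars xs A :: G) C.
Proof.
move=> closedT freshG D; elim: xs freshG => //= x xs IH freshG.
have [freshC {}freshG'] : x \notin fv C /\
    forall B, List.In B G -> x \notin fv B.
  by split=> [|B BG]; apply: freshG; rewrite ?mem_head //=; [left|right].
have {}IH : derives T (ex_vars xs A :: G) C.
  by apply: IH => B BG v v_in; apply: freshG BG _ _; rewrite inE v_in orbT.
apply: (@d_exE _ _ _ x.1 (abs x (ex_vars xs A))); first by apply: d_hyp; left.
rewrite -(abs_fresh freshC) /=.
have := derives_subst closedT (well_sorted_Var (abs_sort x)) IH.
rewrite /= -!/(abs _ _) -/(map (abs x) G) (map_abs_fresh freshG') => D'.
(* [d_exE] keeps the shifted existential in the context, so the derivation is weakened past it. *)
by apply: derives_weaken D' _ => B /= [->|BG]; [left|right; right].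
Qed.

(** Here [f] records the witnesses chosen so far: removing the quantifier on [x] updates [f] at [x]
    to [g x], and once the list is exhausted [f] agrees with [g]. *)
Lemma derives_subst_ex_vars (Sg : signature) (T : form Sg -> Prop)
    (G : seq (form Sg)) (xs : seq (var Sg)) (A : form Sg)
    (f g : var Sg -> term Sg) :
    well_sorted f -> well_sorted g -> wf A ->
    (forall v, v \notin xs -> f v = g v) ->
  derives T G (subst g A) -> derives T G (subst f (ex_vars xs A)).
Proof.
move=> wsf wsg wA + D; elim: xs f wsf => [|x xs IH] f wsf efg /=.
  by rewrite (@eq_subst _ A f g) // => v; apply: efg.
have [sgx wgx] := wsg x.
apply: (d_exI sgx wgx).
  exact/wf_subst/wf_abs/wf_ex_vars/wA/well_sorted_up.
rewrite inst_up_abs; apply: IH => [v|v v_xs]; case: eqP => [->|/eqP nvx] //.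
by apply: efg; rewrite inE negb_or nvx.
Qed.

Lemma derives_ex_vars (Sg : signature) (T : form Sg -> Prop)
    (G : seq (form Sg)) (xs : seq (var Sg)) (A : form Sg)
    (g : var Sg -> term Sg) :
    well_sorted g -> wf A -> (forall v, v \notin xs -> g v = Var v) ->
  derives T G (subst g A) -> derives T G (ex_vars xs A).
Proof.
move=> wsg wA gid D; rewrite -[ex_vars _ _]subst_Var.
by apply: derives_subst_ex_vars D => // v /gid.
Qed.

Lemma derives_all_vars_body (Sg : signature) (T : form Sg -> Prop)
    (G : seq (form Sg)) (xs : seq (var Sg)) (A : form Sg) :
  derives T G (all_vars xs A) -> derives T G A.
Proof.
elim: xs => //= x xs IH D; apply: IH.
have {D} := @d_allE _ _ _ _ _ (Var x) erefl isT D.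
(* Writing the body as its image under [up x.1 (@Var Sg)] gives it the form that [inst_up_abs]
   expects; the result substitutes [x] for itself. *)
rewrite -[abs _ _]subst_Var -(eq_subst _ (@up_Var _ x.1)) inst_up_abs.
by rewrite (@eq_subst _ _ _ (@Var Sg)) ?subst_Var // => v; case: eqP => [->|].
Qed.

Lemma EI_axioms_closed (Sg : signature) (A : form Sg) :
  EI_axioms A -> fv A =i [::].
Proof. by case=> B _ ->; apply: fv_univ_closure. Qed.

(** Stripping the universal closure makes an instance available in any context with its free
    variables open. *)
Lemma derives_schema (Sg : signature) (G : seq (form Sg)) (A : form Sg) :
  EI_schema A -> derives (@EI_axioms Sg) G A.
Proof.
move=> sA; apply: (@derives_all_vars_body _ _ _ (undup (fv A))).
by apply: d_ax; exists A.
Qed.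

(** * Independence and invariance *)

(** Translates [perm_eq] into the tuples and permutations in which (I1) is phrased. *)
Lemma perm_permute (T : eqType) (s t : seq T) : perm_eq s t ->
  exists n (p : 'S_n) (u : n.-tuple T), (u : seq T) = t /\ (permute p u : seq T) = s.
Proof.
move=> pst; have /tuple_permP[p es] : perm_eq s (in_tuple t) by [].
by exists (size t), p, (in_tuple t).
Qed.

Lemma derives_indep_perm (Sg : signature) (G : seq (form Sg))
    (x x' z w : seq (var Sg)) :
  perm_eq x x' -> derives (@EI_axioms Sg) G (indep x z w) ->
  derives (@EI_axioms Sg) G (indep x' z w).
Proof.
rewrite perm_sym => /perm_permute[k [p [tx [ex ex']]]].
(* (I1) permutes all three lists; reflexivity provides permutations that leave [z] and [w] as they
   are. *)
have [m [q [tz [ez ez']]]] := perm_permute (perm_refl z).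
have [n [r [tw [ew ew']]]] := perm_permute (perm_refl w).
by apply/d_impE/derives_schema; have := I1 p q r tx tz tw;
  rewrite ex ex' ez ez' ew ew'.
Qed.

(** (I6) enlarges the second argument, so it is used between two applications of the symmetry (I3).
    It puts [y] in front of [x], and a permutation restores the order. *)
Lemma derives_indep_cat (Sg : signature) (G : seq (form Sg))
    (x y z w : seq (var Sg)) :
  derives (@EI_axioms Sg) G (indep x z w) ->
  derives (@EI_axioms Sg) G (indep y z (x ++ w)) ->
  derives (@EI_axioms Sg) G (indep (x ++ y) z w).
Proof.
move=> Dx Dy; apply: (@derives_indep_perm _ _ (y ++ x)); first exact/permEl/perm_catC.
apply/(d_impE (derives_schema _ (I3 _ _ _)))/(d_impE (derives_schema _ (I6 _ _ _ _))).
by apply: d_andI; apply: d_impE (derives_schema _ (I3 _ _ _)) _.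
Qed.

(** The indices are distinct and exceed every index in [r] regardless of sort, so the sorts can be
    prescribed freely. *)
Lemma exists_fresh (Sg : signature) (ss : seq (sortS Sg)) (r : seq (var Sg)) :
  exists y : seq (var Sg), [/\ sorts y = ss, uniq y & disjoint_vars y r].
Proof.
pose N := (\max_(v <- r) v.2).+1.
have szN : size ss = size (iota N (size ss)) by rewrite size_iota.
exists (zip ss (iota N (size ss))); split.
- by rewrite /sorts -[LHS]/(unzip1 _) unzip1_zip // -szN.
- apply: (@map_uniq _ _ snd); rewrite -[map _ _]/(unzip2 _) unzip2_zip -?szN //.
  exact: iota_uniq.
- apply/hasPn=> v v_in; apply/negP=> v_r.
  have : v.2 \in iota N (size ss).
    by rewrite -(@unzip2_zip _ _ ss (iota _ _)) -?szN //; apply: (map_f snd).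
  by rewrite mem_iota /N ltnNge (@leq_bigmax_seq _ r xpredT snd v).
Qed.

Lemma nth_index_sort (Sg : signature) (x y : seq (var Sg)) (v : var Sg) :
  sorts x = sorts y -> (nth v y (index v x)).1 = v.1.
Proof.
move=> exy; have exy' : size x = size y by have := congr1 size exy; rewrite !size_map.
(* For [v] outside [x] the index is the common length, so the lookup returns its default [v] and the
   sort is kept. *)
case: (ltnP (index v x) (size x)) => [lt|ge]; last by rewrite nth_default -?exy'.
have := congr1 (fun s => nth v.1 s (index v x)) exy.
by rewrite !(nth_map v) -?exy' // nth_index -?index_mem // => <-.
Qed.

Lemma well_sorted_subst_vars (Sg : signature) (x y : seq (var Sg)) :
  sorts x = sorts y -> well_sorted (fun v => Var (nth v y (index v x))).
Proof. by move=> exy; apply: well_sorted_Var => v; apply: nth_index_sort. Qed.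

(* (E6) speaks of a list of distinct variables, whereas [x] may repeat
   variables, so [A] is first renamed along [x] to fresh distinct variables. *)
Lemma derives_invariance (Sg : signature) (G : seq (form Sg))
    (x y : seq (var Sg)) (A : form Sg) (r : var Sg -> var Sg) :
    wf A -> {subset fv A <= x} -> sorts x = sorts y ->
    {in fv A, forall v, nth v y (index v x) = r v} ->
    derives (@EI_axioms Sg) G (Defs.equiv x y) ->
  derives (@EI_axioms Sg) G A ->
  derives (@EI_axioms Sg) G (subst (fun v => Var (r v)) A).
Proof.
move=> wA fvA exy rE Dxy DA.
have [t [ext uniq_t _]] := exists_fresh (sorts x) [::].
have szx : size x = size t by have := congr1 size ext; rewrite !size_map.
have szy : size x = size y by have := congr1 size exy; rewrite !size_map.
pose B := subst_vars x t A.
(* Renaming [x] to [t] and then [t] to [u] is renaming [x] to [u] directly. Below, [u := y] gives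
   the target formula and [u := x] gives [A] back. *)
have BE (u : seq (var Sg)) : size x = size u ->
    subst_vars t u B = subst (fun v => Var (nth v u (index v x))) A.
  move=> szu; rewrite /B /subst_vars subst_comp.
  apply: eq_in_subst => v /fvA v_x /=.
  (* As [v] lies in [x], the position is in range and the two different defaults are never
     returned. *)
  by rewrite index_uniq -?szx ?index_mem //; congr Var;
    apply: set_nth_default; rewrite -szu index_mem.
have wB : wf B by apply: wf_subst wA; apply: well_sorted_subst_vars.
have fvB : {subset fv B <= t}.
  move=> u /fv_subst[v /fvA v_x] /=; rewrite inE => /eqP->.
  by rewrite mem_nth // -szx index_mem.
have := derives_schema G (E6 wB uniq_t fvB (esym ext) (etrans (esym exy) (esym ext))).
rewrite !BE // => D.
rewrite -(@eq_in_subst _ A (fun v => Var (nth v y (index v x)))); last first.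
  by move=> v /rE->.
apply: d_impE D (d_andI Dxy _).
rewrite (@eq_in_subst _ A _ (@Var Sg)) ?subst_Var // => v /fvA v_x.
by rewrite nth_index.
Qed.

(** * Derivation of the schema *)

Theorem theorem7p11 (Sg : signature) (x y z w : seq (var Sg)) (Phi : form Sg)
  (wf_Phi : wf Phi) (fv_Phi : {subset fv Phi <= x ++ y ++ w})
  (uniq_y : uniq y) (uniq_z : uniq z)
  (fresh_y : disjoint_vars y (x ++ w))
  (fresh_z : disjoint_vars z (x ++ y ++ w)) :
  derives (@EI_axioms Sg) [::]
    (Imp (ex_vars y Phi)
         (all_vars z (Imp (indep x z w)
            (ex_vars y (And (indep (x ++ y) z w) Phi))))).
Proof.
(* The order in which (I7) lists these variables when its base is [x ++ w]. *)
have fv_Phi' : {subset fv Phi <= y ++ x ++ w}.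
  by move=> v /fv_Phi; rewrite !mem_cat orbCA.
apply: d_impI; first exact: wf_ex_vars.
apply: derives_all_vars; first exact: EI_axioms_closed.
  move=> _ [<-|//] v v_z; apply/negP=> /fv_ex_vars[/fv_Phi v_in _].
  by have /hasPn/(_ v v_z)/negP := fresh_z.
apply: d_impI; first exact: wf_indep.
set C := ex_vars y (And _ Phi).
(* A copy of the existential hypothesis moves to the head of the context, where it can be opened. *)
apply: (@derives_cut _ _ _ (ex_vars y Phi)); first exact: wf_ex_vars.
  by apply: d_hyp; right; left.
(* The variables of [y] are bound in the goal and in the retained existential, and they avoid [x],
   [z] and [w]. *)
apply: derives_ex_vars_hyp; first exact: EI_axioms_closed.
  move=> B inB v v_y; apply/negP; case: inB => [<-|[<-|[<-|//]]].
  - by move=> /fv_ex_vars[_]; rewrite v_y.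
  - rewrite fv_indep !mem_cat => v_in; have /hasPn/(_ v v_y) /= := fresh_y.
    rewrite mem_cat; case/or3P: v_in => [->|v_z|->]; rewrite ?orbT //.
    by have /hasPn/(_ v v_z) := fresh_z; rewrite /= !mem_cat v_y !orbT.
  - by move=> /fv_ex_vars[_]; rewrite v_y.
(* [y'] avoids all variables in play: it is the list bound in (I7) and then supplies the
   eigenvariables when that existential is opened. *)
have [y' [sy' uniq_y' fresh_y']] := exists_fresh (sorts y) (y ++ z ++ x ++ w).
have ssE : sorts (y' ++ x ++ w) = sorts (y ++ x ++ w).
  by rewrite /sorts !map_cat -/(sorts y') sy'.
have szy' : size y' = size y by have := congr1 size sy'; rewrite !size_map.
apply: derives_cut (derives_schema _ (I7 sy' uniq_y' fresh_y')) _.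
  by apply: wf_ex_vars; rewrite /= -!/(wf _); apply/andP; split;
    [apply: wf_equiv|apply: wf_indep].
apply: derives_ex_vars_hyp; first exact: EI_axioms_closed.
  have fresh v : v \in y' -> v \in x ++ y ++ z ++ w -> False.
    move=> v_y'; have /hasPn/(_ v v_y') /= := fresh_y'.
    rewrite !mem_cat => /negP nin v_in; apply: nin.
    by case/or4P: v_in => ->; rewrite ?orbT.
  have freshPhi v : v \in y' -> v \in fv Phi -> False.
    move=> v_y' /fv_Phi v_in; apply: (fresh v v_y'); move: v_in.
    by rewrite !mem_cat => /or3P[] ->; rewrite ?orbT.
  move=> B inB v v_y'; apply/negP; case: inB => [<-|[<-|[<-|[<-|//]]]].
  - move=> /fv_ex_vars[+ _]; rewrite -[fv _]/(fv (indep (x ++ y) z w) ++ fv Phi).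
    rewrite mem_cat fv_indep -catA => /orP[].
      exact: fresh.
    exact: freshPhi.
  - exact: freshPhi.
  - rewrite fv_indep => v_in; apply: (fresh v v_y'); move: v_in.
    by rewrite !mem_cat => /or3P[] ->; rewrite ?orbT.
  - by move=> /fv_ex_vars[/(freshPhi v v_y')].
set G := _ :: _.
have Dhyp : derives (@EI_axioms Sg) G
    (And (Defs.equiv (y' ++ x ++ w) (y ++ x ++ w)) (indep y' z (x ++ w))).
  by apply: d_hyp; left.
(* The witnesses for the goal: [r] sends each variable of [y] to its counterpart in [y'], and the
   default [v] fixes every other variable. *)
pose r v := nth v y' (index v y).
have rid v : v \notin y -> r v = v.
  by move=> v_y; rewrite /r nth_default // szy' leqNgt index_mem.
apply: (@derives_ex_vars _ _ _ _ _ (fun v => Var (r v))).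
- exact: well_sorted_subst_vars.
- by rewrite -[wf _]/(wf (indep _ _ _) && wf Phi) wf_indep.
- by move=> v /rid->.
have map_rid u : (forall v, v \in u -> v \notin y) -> map r u = u.
  by move=> u_y; rewrite -[RHS]map_id; apply/eq_in_map => v /u_y/rid.
have map_r_y : map r y = y'.
  (* A nonempty [y] supplies a default [v0] for comparing the lists by position; since [y] has no
     repetitions, its entry at position [i] has index [i]. *)
  case: (y) uniq_y szy' @r {rid map_rid} => [|v0 ys] uniq_ys szys r.
    by rewrite (size0nil szys).
  apply: (@eq_from_nth _ v0); rewrite size_map // => i lt.
  by rewrite (nth_map v0) // /r index_uniq //; apply: set_nth_default; rewrite szys.
apply: (@d_andI _ _ _ (subst _ (indep (x ++ y) z w)) (subst _ Phi)).
  rewrite subst_indep map_cat map_r_y !map_rid; first last.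
  - move=> v v_x; apply/negP=> v_y; have /hasPn/(_ v v_y) := fresh_y.
    by rewrite /= mem_cat v_x.
  - move=> v v_z; apply/negP=> v_y; have /hasPn/(_ v v_z) := fresh_z.
    by rewrite /= !mem_cat v_y orbT.
  - move=> v v_w; apply/negP=> v_y; have /hasPn/(_ v v_y) := fresh_y.
    by rewrite /= mem_cat v_w orbT.
  (* The copy [y'] is independent of [z] over [x ++ w] by (I7), and [x] is independent of [z] over
     [w] by hypothesis. *)
  apply: derives_indep_cat (d_andE2 Dhyp).
  by apply: d_hyp; right; right; left.
apply: (@derives_invariance _ _ (y ++ x ++ w) (y' ++ x ++ w)) => //.
(* Renaming by position along the full lists agrees with [r]: within [y] both look up [y'], and past
   [y] the offsets cancel, so [v] is returned. *)
- move=> v /fv_Phi' v_in; rewrite index_cat /r; case: ifP => v_y.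
    by rewrite nth_cat szy' index_mem v_y.
  rewrite nth_cat szy' ltnNge leq_addr /= addKn nth_index; last first.
    by move: v_in; rewrite mem_cat v_y.
  by rewrite nth_default // szy' leqNgt index_mem v_y.
(* (I7) yields the equivalence with [y'] on the left; (E2) turns it round so that [Phi] is carried
   from [y] to [y']. *)
- exact: d_impE (derives_schema _ (E2 ssE)) (d_andE1 Dhyp).
- by apply: d_hyp; right; left.
Qed.
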